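(* Let $(V,\mathcal{Y},c)$ be a vertex coalgebra and let $D^*=\mathrm{Res}_x\, x^{-2}(Id_V\otimes c)\mathcal{Y}(x):V\to V$. Then $$T\,\mathcal{Y}(x)=\mathcal{Y}(-x)e^{xD^*}.$$
   Context: All vector spaces are over a field $\mathbb{F}$ of characteristic $0$, and $x,x_0,x_1,x_2$ are commuting formal variables. $\delta(x)=\sum_{n\in\mathbb{Z}}x^n$. For $n\in\mathbb{Z}$, $(x_i\pm x_j)^n$ is expanded in nonnegative integral powers of the second listed variable $x_j$ (this also applies inside $\delta$). $\mathrm{Res}_x$ denotes the coefficient of $x^{-1}$. For a vector space $W$, $W[[x,x^{-1}]]$ is the space of all doubly infinite formal series, and $W((x^{-1}))$ is the space of formal series with only finitely many positive powers of $x$. $T:V\otimes V\to V\otimes V$ is the transposition $T(u\otimes v)=v\otimes u$. Linear maps act on formal series coefficientwise, and $e^{xD^*}=\sum_{n\ge0}\frac{x^n}{n!}(D^* )^n$ is the formal exponential. A vertex coalgebra $(V,\mathcal{Y},c)$ is a vector space $V$ with linear maps $\mathcal{Y}(x):V\to(V\otimes V)[[x,x^{-1}]]$ (coproduct) and $c:V\to\mathbb{F}$ (covacuum map) such that for all $v\in V$: 1. Left counit: $(c\otimes Id_V)\mathcal{Y}(x)v=v$. 2. Cocreation: $(Id_V\otimes c)\mathcal{Y}(x)v\in V[[x]]$ and $\lim_{x\to0}(Id_V\otimes c)\mathcal{Y}(x)v=v$. 3. Truncation: $\mathcal{Y}(x)v\in(V\otimes V)((x^{-1}))$. 4. Jacobi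 identity: $$x_0^{-1}\delta\left(\tfrac{x_1-x_2}{x_0}\right)(Id_V\otimes\mathcal{Y}(x_2))\mathcal{Y}(x_1)-x_0^{-1}\delta\left(\tfrac{x_2-x_1}{-x_0}\right)(T\otimes Id_V)(Id_V\otimes\mathcal{Y}(x_1))\mathcal{Y}(x_2)=x_2^{-1}\delta\left(\tfrac{x_1-x_0}{x_2}\right)(\mathcal{Y}(x_0)\otimes Id_V)\mathcal{Y}(x_2).$$ *)

(* Defs.v *)
From HB Require Import structures.
From mathcomp Require Import all_boot all_order all_algebra.
From mathcomp Require Import boolp classical_sets functions cardinality fsbigop.

Set Implicit Arguments.
Unset Strict Implicit.
Unset Printing Implicit Defensive.

Import GRing.Theory.

Local Open Scope ring_scope.
Local Open Scope quotient_scope.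

(* The library has no tensor product of arbitrary vector spaces.  Here U (x) V
   is the quotient of the formal finite sums of pairs (u, v), encoded as lists,
   by the congruence generated by the bilinearity relations; a scalar a acts by
   (u, v) |-> (a u, v).  [tensor_liftE] and [tensor_ext] below give the
   universal property. *)
Section TensorSpace.
Variables (F : fieldType) (U V : lmodType F).
Local Notation word := (seq (U * V)).

Inductive tensor_rel : word -> word -> Prop :=
| tensor_refl s : tensor_rel s s
| tensor_sym s t : tensor_rel s t -> tensor_rel t s
| tensor_trans s t r : tensor_rel s t -> tensor_rel t r -> tensor_rel s r
| tensor_cat s s' t t' :
    tensor_rel s s' -> tensor_rel t t' -> tensor_rel (s ++ t) (s' ++ t')
| tensor_comm s t : tensor_rel (s ++ t) (t ++ s)
| tensor_zero v : tensor_rel [:: (0, v)] [::]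
| tensor_addl u u' v : tensor_rel [:: (u + u', v)] [:: (u, v); (u', v)]
| tensor_addr u v v' : tensor_rel [:: (u, v + v')] [:: (u, v); (u, v')]
| tensor_scale (a : F) u v : tensor_rel [:: (a *: u, v)] [:: (u, a *: v)].

Definition tensor_relb : rel word := fun s t => `[< tensor_rel s t >].

Lemma tensor_relb_equiv : equiv_class_of tensor_relb.
Proof.
split=> [s|s t|t s r].
- by apply/asboolP; exact: tensor_refl.
- by apply/asboolP/asboolP; exact: tensor_sym.
- by move=> /asboolP st /asboolP tr; apply/asboolP; exact: tensor_trans st tr.
Qed.

Canonical tensor_equiv := EquivRelPack tensor_relb_equiv.

Definition tensor : Type := {eq_quot tensor_relb}.
HB.instance Definition _ := Choice.on tensor.
HB.instance Definition _ := EqQuotient.on tensor.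

Lemma tensor_piP (s t : word) : (\pi_tensor s = \pi_tensor t) <-> tensor_rel s t.
Proof.
split=> [/eqP|st]; first by rewrite eqmodE => /asboolP.
by apply/eqP; rewrite eqmodE; apply/asboolP.
Qed.

Lemma tensor_quotW (P : tensor -> Prop) :
  (forall s : word, P (\pi_tensor s)) -> forall t, P t.
Proof. by move=> h t; rewrite -[t]reprK. Qed.

Lemma tensor_reprP (s : word) : tensor_rel (repr (\pi_tensor s)) s.
Proof. by apply/tensor_piP; rewrite reprK. Qed.

Definition word_scale (a : F) (s : word) : word := [seq (a *: p.1, p.2) | p <- s].

Lemma word_scale_rel a s t :
  tensor_rel s t -> tensor_rel (word_scale a s) (word_scale a t).
Proof.
elim=> {s t} [s|s t _ h|s t r _ h _ h'|s s' t t' _ h _ h'|s t|v|u u' v|u v v'|b u v].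
- exact: tensor_refl.
- exact: tensor_sym.
- exact: tensor_trans h h'.
- by rewrite /word_scale !map_cat; exact: tensor_cat.
- by rewrite /word_scale !map_cat; exact: tensor_comm.
- by rewrite /= scaler0; exact: tensor_zero.
- by rewrite /= scalerDr; exact: tensor_addl.
- exact: tensor_addr.
- by rewrite /= scalerA mulrC -scalerA; exact: tensor_scale.
Qed.

Lemma word_scaleDl a b s :
  tensor_rel (word_scale (a + b) s) (word_scale a s ++ word_scale b s).
Proof.
elim: s => [|[u v] s IH] /=; first exact: tensor_refl.
rewrite scalerDl -cat1s.
apply: tensor_trans (tensor_cat (tensor_addl _ _ _) IH) _.
rewrite -[X in tensor_rel _ X]cat1s -[X in tensor_rel X _]/([:: _] ++ [:: _] ++ _ ++ _).
apply: tensor_cat; first exact: tensor_refl.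
rewrite -[X in tensor_rel _ (_ ++ X)]cat1s !catA.
apply: tensor_cat; [exact: tensor_comm | exact: tensor_refl].
Qed.

Lemma word_scale0 s : tensor_rel (word_scale 0 s) [::].
Proof.
elim: s => [|[u v] s IH] /=; first exact: tensor_refl.
rewrite scale0r -cat1s -[X in tensor_rel _ X]cats0.
exact: tensor_cat (tensor_zero _) IH.
Qed.

Lemma word_scale1 s : word_scale 1 s = s.
Proof. by rewrite /word_scale map_id_in // => -[u v] _; rewrite scale1r. Qed.

Definition tensor0 : tensor := \pi_tensor [::].
Definition tensor_add (s t : tensor) : tensor := \pi_tensor (repr s ++ repr t).
Definition tensor_scalar (a : F) (t : tensor) : tensor := \pi_tensor (word_scale a (repr t)).
Definition tensor_opp (t : tensor) : tensor := tensor_scalar (-1) t.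

Lemma pi_tensor_add (s t : word) :
  tensor_add (\pi_tensor s) (\pi_tensor t) = \pi_tensor (s ++ t).
Proof. by apply/tensor_piP; apply: tensor_cat; exact: tensor_reprP. Qed.

Lemma pi_tensor_scalar a (s : word) :
  tensor_scalar a (\pi_tensor s) = \pi_tensor (word_scale a s).
Proof. by apply/tensor_piP; apply: word_scale_rel; exact: tensor_reprP. Qed.

Lemma tensor_addA : associative tensor_add.
Proof.
by elim/tensor_quotW=> s; elim/tensor_quotW=> t; elim/tensor_quotW=> r; rewrite !pi_tensor_add catA.
Qed.

Lemma tensor_addC : commutative tensor_add.
Proof.
elim/tensor_quotW=> s; elim/tensor_quotW=> t; rewrite !pi_tensor_add.
by apply/tensor_piP; exact: tensor_comm.
Qed.

Lemma tensor_add0 : left_id tensor0 tensor_add.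
Proof. by elim/tensor_quotW=> s; rewrite pi_tensor_add. Qed.

Lemma tensor_addN : left_inverse tensor0 tensor_opp tensor_add.
Proof.
elim/tensor_quotW=> s; rewrite /tensor_opp pi_tensor_scalar pi_tensor_add.
apply/tensor_piP; rewrite -{2}[s]word_scale1.
apply: tensor_trans (tensor_sym (word_scaleDl _ _ _)) _.
by rewrite addNr; exact: word_scale0.
Qed.

HB.instance Definition _ :=
  GRing.isZmodule.Build tensor tensor_addA tensor_addC tensor_add0 tensor_addN.

Lemma pi_tensorD (s t : word) : \pi_tensor s + \pi_tensor t = \pi_tensor (s ++ t).
Proof. exact: pi_tensor_add. Qed.

Lemma tensor_scalarA a b t :
  tensor_scalar a (tensor_scalar b t) = tensor_scalar (a * b) t.
Proof.
elim/tensor_quotW: t => s; rewrite !pi_tensor_scalar /word_scale -map_comp.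
by congr (\pi_tensor _); apply: eq_map => -[u v] /=; rewrite scalerA.
Qed.

Lemma tensor_scalar1 : left_id 1 tensor_scalar.
Proof. by elim/tensor_quotW=> s; rewrite pi_tensor_scalar word_scale1. Qed.

Lemma tensor_scalarDr : right_distributive tensor_scalar +%R.
Proof.
move=> a t1 t2; elim/tensor_quotW: t1 => s; elim/tensor_quotW: t2 => t.
by rewrite pi_tensorD !pi_tensor_scalar pi_tensorD /word_scale map_cat.
Qed.

Lemma tensor_scalarDl t : {morph tensor_scalar^~ t : a b / a + b}.
Proof.
elim/tensor_quotW: t => s a b; rewrite !pi_tensor_scalar pi_tensorD.
by apply/tensor_piP; exact: word_scaleDl.
Qed.

HB.instance Definition _ := GRing.Zmodule_isLmodule.Build F tensor
  tensor_scalarA tensor_scalar1 tensor_scalarDr tensor_scalarDl.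

Lemma pi_tensorZ a (s : word) : a *: \pi_tensor s = \pi_tensor (word_scale a s).
Proof. exact: pi_tensor_scalar. Qed.

Definition pure (u : U) (v : V) : tensor := \pi_tensor [:: (u, v)].

Lemma pure_bilinear : bilinear_for *:%R *:%R pure.
Proof.
split=> [v a u u'|u a v v'].
- rewrite /= pi_tensorZ pi_tensorD; apply/esym.
  by apply/tensor_piP; exact/tensor_sym/tensor_addl.
- rewrite /= pi_tensorZ pi_tensorD.
  apply/tensor_piP; apply: tensor_trans (tensor_addr _ _ _) _.
  rewrite -cat1s; apply: tensor_cat (tensor_refl _).
  by apply: tensor_sym; exact: tensor_scale.
Qed.

HB.instance Definition _ := bilinear_isBilinear.Build F U V tensor
  ( *:%R ) ( *:%R ) pure pure_bilinear.

HB.instance Definition _ (u : U) :=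
  GRing.isLinear.Build F V tensor *:%R (pure u) (pure_bilinear.2 u).

Lemma pi_tensor_sum (s : word) :
  \pi_tensor s = \sum_(p <- s) pure p.1 p.2.
Proof.
elim: s => [|[u v] s IH]; first by rewrite big_nil.
by rewrite big_cons -IH pi_tensorD.
Qed.

Lemma tensor_sum (t : tensor) : t = \sum_(p <- repr t) pure p.1 p.2.
Proof. by rewrite -pi_tensor_sum reprK. Qed.

Lemma tensor_ext (W : lmodType F) (f g : {linear tensor -> W}) :
  (forall u v, f (pure u v) = g (pure u v)) -> f =1 g.
Proof.
by move=> fg t; rewrite (tensor_sum t) !linear_sum; apply: eq_bigr.
Qed.

Section Lift.
Variables (W : lmodType F) (f : {bilinear U -> V -> W}).

Definition tensor_lift (t : tensor) : W := \sum_(p <- repr t) f p.1 p.2.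

Lemma lift_rel (s t : word) : tensor_rel s t ->
  \sum_(p <- s) f p.1 p.2 = \sum_(p <- t) f p.1 p.2.
Proof.
elim=> {s t} //=.
- by move=> s t r _ -> _ ->.
- by move=> s s' t t' _ h _ h'; rewrite !big_cat /= h h'.
- by move=> s t; rewrite !big_cat /= addrC.
- by move=> v; rewrite big_seq1 big_nil /= linear0l.
- by move=> u u' v; rewrite !big_cons !big_nil !addr0 /= linearDl.
- by move=> u v v'; rewrite !big_cons !big_nil !addr0 /= linearDr.
- by move=> a u v; rewrite !big_seq1 /= linearZl_LR linearZr_LR.
Qed.

Lemma tensor_lift_pi (s : word) :
  tensor_lift (\pi_tensor s) = \sum_(p <- s) f p.1 p.2.
Proof. by apply: lift_rel; exact: tensor_reprP. Qed.

Lemma tensor_lift_linear : linear tensor_lift.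
Proof.
move=> a t1 t2; elim/tensor_quotW: t1 => s; elim/tensor_quotW: t2 => t.
rewrite pi_tensorZ pi_tensorD.
rewrite !tensor_lift_pi big_cat /= big_map scaler_sumr; congr (_ + _).
by apply: eq_bigr => p _; rewrite /= linearZl_LR.
Qed.

HB.instance Definition _ :=
  GRing.isLinear.Build F tensor W *:%R tensor_lift tensor_lift_linear.

Lemma tensor_liftE u v : tensor_lift (pure u v) = f u v.
Proof. by rewrite tensor_lift_pi big_seq1. Qed.

End Lift.
End TensorSpace.

Notation "U ⊗ V" := (tensor U V) (at level 40, left associativity) : type_scope.

Section TensorMaps.
Variable F : fieldType.

Section Map.
Variables (U V U' V' : lmodType F).
Variables (f : {linear U -> U'}) (g : {linear V -> V'}).

Definition pure_map (u : U) (v : V) : U' ⊗ V' := pure (f u) (g v).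

Lemma pure_map_bilinear : bilinear_for *:%R *:%R pure_map.
Proof.
split=> [v|u] a x y; rewrite /pure_map linearP; first exact: linearPl.
exact: linearPr.
Qed.

HB.instance Definition _ := bilinear_isBilinear.Build F U V (U' ⊗ V')
  ( *:%R ) ( *:%R ) pure_map pure_map_bilinear.

Definition tensor_map : U ⊗ V -> U' ⊗ V' := tensor_lift pure_map.
HB.instance Definition _ := GRing.Linear.on tensor_map.

Lemma tensor_mapE u v : tensor_map (pure u v) = pure (f u) (g v).
Proof. exact: tensor_liftE. Qed.
End Map.

Section Swap.
Variables (U V : lmodType F).

Definition pure_swap (u : U) (v : V) : V ⊗ U := pure v u.

Lemma pure_swap_bilinear : bilinear_for *:%R *:%R pure_swap.
Proof.
by split=> [v|u] a x y; [exact: linearPr | exact: linearPl].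
Qed.

HB.instance Definition _ := bilinear_isBilinear.Build F U V (V ⊗ U)
  ( *:%R ) ( *:%R ) pure_swap pure_swap_bilinear.

Definition tensor_swap : U ⊗ V -> V ⊗ U := tensor_lift pure_swap.
HB.instance Definition _ := GRing.Linear.on tensor_swap.

Lemma tensor_swapE u v : tensor_swap (pure u v) = pure v u.
Proof. exact: tensor_liftE. Qed.
End Swap.

Section Assoc.
Variables (U V W : lmodType F).

Definition pure_assoc (u : U) (t : V ⊗ W) : U ⊗ V ⊗ W :=
  tensor_map (pure u) idfun t.

Lemma pure_assoc_bilinear : bilinear_for *:%R *:%R pure_assoc.
Proof.
split=> [t|u] a x y; last exact: linearP.
have E z : pure_assoc z t = \sum_(p <- repr t) pure (pure z p.1) p.2 by [].
rewrite /= !E scaler_sumr -big_split /=.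
by apply: eq_bigr => p _; rewrite !linearPl.
Qed.

HB.instance Definition _ := bilinear_isBilinear.Build F U (V ⊗ W) (U ⊗ V ⊗ W)
  ( *:%R ) ( *:%R ) pure_assoc pure_assoc_bilinear.

Definition tensor_assoc : U ⊗ (V ⊗ W) -> U ⊗ V ⊗ W := tensor_lift pure_assoc.
HB.instance Definition _ := GRing.Linear.on tensor_assoc.

Lemma tensor_assocE u v w :
  tensor_assoc (pure u (pure v w)) = pure (pure u v) w.
Proof. by rewrite [LHS]tensor_liftE [LHS]tensor_mapE. Qed.
End Assoc.

Section Unitors.
Variable U : lmodType F.

Definition pure_unitl (a : F^o) (u : U) : U := a *: u.
Definition pure_unitr (u : U) (a : F^o) : U := a *: u.

Lemma pure_unitl_bilinear : bilinear_for *:%R *:%R pure_unitl.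
Proof.
split=> [u|b] a x y; rewrite /pure_unitl.
- by rewrite /= scalerDl; congr (_ + _); rewrite scalerA.
- by rewrite /= scalerDr !scalerA mulrC.
Qed.

Lemma pure_unitr_bilinear : bilinear_for *:%R *:%R pure_unitr.
Proof.
by case: pure_unitl_bilinear => hl hr; split=> [a|u]; [exact: hr | exact: hl].
Qed.

HB.instance Definition _ := bilinear_isBilinear.Build F F^o U U
  ( *:%R ) ( *:%R ) pure_unitl pure_unitl_bilinear.
HB.instance Definition _ := bilinear_isBilinear.Build F U F^o U
  ( *:%R ) ( *:%R ) pure_unitr pure_unitr_bilinear.

Definition tensor_unitl : F^o ⊗ U -> U := tensor_lift pure_unitl.
HB.instance Definition _ := GRing.Linear.on tensor_unitl.

Definition tensor_unitr : U ⊗ F^o -> U := tensor_lift pure_unitr.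
HB.instance Definition _ := GRing.Linear.on tensor_unitr.

Lemma tensor_unitlE a u : tensor_unitl (pure a u) = a *: u.
Proof. exact: tensor_liftE. Qed.

Lemma tensor_unitrE u a : tensor_unitr (pure u a) = a *: u.
Proof. exact: tensor_liftE. Qed.
End Unitors.
End TensorMaps.

(* W[[x, x^-1]]: the value at n is the coefficient of x^n. *)
Notation series W := (int -> W).

(* W[[x0, x0^-1, x1, x1^-1, x2, x2^-1]]: the value at (i, j, k) is the
   coefficient of x0^i x1^j x2^k. *)
Notation series3 W := (int * int * int -> W).

Section Series.
Variable F : fieldType.

Section OneSpace.
Variable W : lmodType F.

(* x^k s(x) *)
Definition series_shift (k : int) (s : series W) : series W := fun n => s (n - k).

Definition series_res (s : series W) : W := s (-1).

(* s(-x) *)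
Definition series_opp (s : series W) : series W := fun n => (-1 : F) ^ n *: s n.

Definition series_const (w : W) : series W := fun n => if n == 0 then w else 0.

(* s lies in W[[x]] *)
Definition no_negative_powers (s : series W) : Prop := forall n, n < 0 -> s n = 0.

(* s lies in W((x^-1)) *)
Definition finitely_many_positive_powers (s : series W) : Prop :=
  exists N : int, forall n, N < n -> s n = 0.

(* e^{xD} w *)
Definition exp_series (D : W -> W) (w : W) : series W := fun n =>
  if n is Posz k then (k`!%:R : F)^-1 *: iter k D w else 0.

(* The product of a scalar series and a W-valued series.  [\sum_(i \in setT)]
   is the sum over the support, which is finite in all the uses below. *)
Definition series3_mul (d : series3 F) (s : series3 W) : series3 W :=
  fun m => \sum_(i \in setT) d i *: s (m - i).

End OneSpace.

Section Apply.
Variables (W W' : lmodType F) (A : W -> series W') (s : series W).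

(* A(x) s(x), where A(x) acts on the coefficients of s; the terms of the sum
   that computes a coefficient are A(x)_(n-i) s_i. *)
Definition series_applicable : Prop :=
  forall n : int, finite_set [set i : int | A (s i) (n - i) != 0].

Definition series_apply : series W' :=
  fun n => \sum_(i \in setT) A (s i) (n - i).
End Apply.

Section Coefficient.
Variables (W W' : lmodType F) (A : {linear W -> series W'}) (n : int).

Definition coef (w : W) : W' := A w n.

Lemma coef_linear : linear coef.
Proof. by move=> a u v; rewrite /coef linearP. Qed.

HB.instance Definition _ := GRing.isLinear.Build F W W' *:%R coef coef_linear.
End Coefficient.

(* n (n - 1) ... (n - k + 1) / k! *)
Definition binomz (n : int) (k : nat) : F :=
  (\prod_(i < k) (n - i%:Z)%:~R) / k`!%:R.

(* The coefficient of y^p z^q in (y - z)^n, expanded in nonnegative powers of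
   z. *)
Definition subpow (n p q : int) : F :=
  if q is Posz k then
    if p + q == n then binomz n k * (-1) ^+ k else 0
  else 0.

(* In a monomial x0^i x1^j x2^k of y^-1 delta (z / y) = sum_n y^(-n-1) z^n the
   index n is read off the exponent of y. *)

(* x0^-1 delta ((x1 - x2) / x0) *)
Definition delta_x1_x2 : series3 F :=
  fun '(i, j, k) => subpow (- i - 1) j k.

(* x0^-1 delta ((x2 - x1) / (- x0)) *)
Definition delta_x2_x1 : series3 F :=
  fun '(i, j, k) => (-1) ^ (- i - 1) * subpow (- i - 1) k j.

(* x2^-1 delta ((x1 - x0) / x2) *)
Definition delta_x1_x0 : series3 F :=
  fun '(i, j, k) => subpow (- k - 1) j i.

End Series.

Section VertexCoalgebra.
Variables (F : fieldType) (V : lmodType F).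
Variables (Y : {linear V -> series (V ⊗ V)}) (c : {linear V -> F^o}).

(* (c (x) Id) Y(x) v *)
Definition counitl (v : V) : series V :=
  fun n => tensor_unitl (tensor_map c idfun (Y v n)).

(* (Id (x) c) Y(x) v *)
Definition counitr (v : V) : series V :=
  fun n => tensor_unitr (tensor_map idfun c (Y v n)).

(* The three-fold tensor products are all brought to (V (x) V) (x) V. *)

(* (Id (x) Y(x2)) Y(x1) v *)
Definition Id_Yx2_Yx1 (v : V) : series3 (V ⊗ V ⊗ V) := fun '(i, j, k) =>
  if i == 0 then tensor_assoc (tensor_map idfun (coef Y k) (Y v j)) else 0.

(* (T (x) Id) (Id (x) Y(x1)) Y(x2) v *)
Definition T_Id_Yx1_Yx2 (v : V) : series3 (V ⊗ V ⊗ V) := fun '(i, j, k) =>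
  if i == 0 then
    tensor_map (@tensor_swap F V V) idfun
      (tensor_assoc (tensor_map idfun (coef Y j) (Y v k)))
  else 0.

(* (Y(x0) (x) Id) Y(x2) v *)
Definition Yx0_Id_Yx2 (v : V) : series3 (V ⊗ V ⊗ V) := fun '(i, j, k) =>
  if j == 0 then tensor_map (coef Y i) idfun (Y v k) else 0.

Record is_vertex_coalgebra : Prop := IsVertexCoalgebra {
  left_counit : forall v, counitl v = series_const v;
  cocreation : forall v, no_negative_powers (counitr v) /\ counitr v 0 = v;
  truncation : forall v, finitely_many_positive_powers (Y v);
  jacobi : forall v,
    series3_mul (delta_x1_x2 F) (Id_Yx2_Yx1 v)
      - series3_mul (delta_x2_x1 F) (T_Id_Yx1_Yx2 v)
    = series3_mul (delta_x1_x0 F) (Yx0_Id_Yx2 v)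
}.

(* Res_x x^-2 (Id (x) c) Y(x) *)
Definition Dstar (v : V) : V := series_res (series_shift (-2) (counitr v)).

End VertexCoalgebra.

(* Main.v *)
Require Import Defs.
From HB Require Import structures.
From mathcomp Require Import all_boot all_order all_algebra.
From mathcomp Require Import boolp classical_sets functions cardinality fsbigop.
From mathcomp Require Import zify.

Set Implicit Arguments.
Unset Strict Implicit.
Unset Printing Implicit Defensive.

Import GRing.Theory.
Local Open Scope ring_scope.

(** Write E(x) = (Id ⊗ c) Y(x).  The idea is to apply the counit c to the last
    tensor factor of the Jacobi identity, which turns it into
      x0^-1 δ((x1 - x2)/x0) (Id ⊗ E(x2)) Y(x1)
        - x0^-1 δ((x2 - x1)/(-x0)) T (Id ⊗ E(x1)) Y(x2)
      = x2^-1 δ((x1 - x0)/x2) Y(x0) E(x2),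
    and to read off well-chosen coefficients of the result
    ([cocreation_jacobi]).  By cocreation E(x) has no negative powers and
    constant term Id, which kills almost everything.

    - The coefficient of x0^m x1^0 x2^-1 has no first term, because E has no
      coefficient of negative index; the second term reduces to (-1)^m T Y_m,
      and the right-hand side is the sum over i >= 0 of (-1)^i Y_(m-i) E_i.  This
      is T Y(x) = Y(-x) E(x) ([swap_coef]).

    - It remains to see that E(x) = exp(x D), where D = E_1 is [Dstar]
      ([exp_series_cocreate]).  Applying c once more and taking the coefficient
      of x0^n x1^-1 x2^1 gives E_n E_1 = (n + 1) E_(n+1) ([cocreate_Dstar]), so
      that n! E_n = D^n; dividing by n! uses characteristic 0.

    That Y(-x) exp(x D) v is well defined at all is not a formal matter, since
    x D raises powers of x while Y(-x) may involve arbitrarily negative ones.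
    It holds because the truncation axiom bounds the powers of x in E(x) v:
    D is locally nilpotent ([cocreate_trunc]). *)

(** * Coefficients of the delta functions *)

(** The sums over the support that define the products of series run over
    triples of integers, but each of their supports lies on a half-line
    parametrized by a natural number and is cut off by truncation. *)
Lemma fsum_nat (I : choiceType) (W : zmodType) (phi : nat -> I) (f : I -> W)
    (K : nat) :
  injective phi ->
  (forall i, f i != 0 -> exists2 k, (k < K)%N & i = phi k) ->
  \sum_(i \in setT) f i = \sum_(k < K) f (phi k).
Proof.
move=> phi_inj supp.
rewrite (@fsbigE _ _ _ _ _ (map phi (iota 0 K))) //=.
- rewrite big_map -(big_mkord predT (fun k => f (phi k))) /index_iota subn0.
  by apply: eq_bigl => k; rewrite mem_set.
- by rewrite map_inj_uniq ?iota_uniq.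
- move=> i _; apply: contraNeq => /supp [k ltkK ->].
  by apply: map_f; rewrite mem_iota.
Qed.

Section Binomials.
Variable F : fieldType.

Lemma binomz0 n : binomz F n 0 = 1.
Proof. by rewrite /binomz big_ord0 fact0 divr1. Qed.

Lemma binomz1 n : binomz F n 1 = n%:~R.
Proof. by rewrite /binomz big_ord1 subr0 divr1. Qed.

Lemma binomz_id (charF : [pchar F] =i pred0) (n : nat) : binomz F n n = 1.
Proof.
have fact_neq0 : n`!%:R != 0 :> F by rewrite ((pcharf0P F).1 charF) -lt0n fact_gt0.
rewrite /binomz (_ : \prod_(i < n) _ = n`!%:R) ?divff //.
rewrite -ffactnn ffact_prod natr_prod; apply: eq_bigr => i _.
by rewrite subzn ?pmulrn // ltnW.
Qed.

Lemma binomz_pred (n : nat) : (0 < n)%N -> binomz F (n%:Z - 1) n = 0.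
Proof.
case: n => // n _; rewrite /binomz big_ord_recr /=.
by rewrite (_ : n.+1%:Z - 1 - n%:Z = 0) ?mulr0 ?mul0r //; lia.
Qed.

Lemma subpowN n (k : nat) : subpow F n (n - k%:Z) k = binomz F n k * (-1) ^+ k.
Proof. by rewrite /subpow subrK eqxx. Qed.

Lemma subpow_neq0 n p q :
  subpow F n p q != 0 -> exists2 k : nat, q = k & p = n - k%:Z.
Proof.
case: q => [k|k] /=; last by rewrite eqxx.
case: (p + k =P n) => [<- _|_]; last by rewrite eqxx.
by exists k; rewrite ?addrK.
Qed.

End Binomials.

(** * The counit on the last tensor factor *)

Section Counit.
Variables (F : fieldType) (U V : lmodType F) (c : {linear V -> F^o}).

Definition rcounit (t : U ⊗ V) : U := tensor_unitr (tensor_map idfun c t).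
HB.instance Definition _ := GRing.Linear.copy rcounit
  (@tensor_unitr F U \o tensor_map (idfun : {linear U -> U}) c).

Lemma rcounit_pure u v : rcounit (pure u v) = (c v : F) *: u.
Proof. by rewrite /rcounit tensor_mapE tensor_unitrE. Qed.

Lemma rcounit_sum K (a : 'I_K -> F) (f : 'I_K -> U ⊗ V) :
  rcounit (\sum_(k < K) a k *: f k) = \sum_(k < K) a k *: rcounit (f k).
Proof.
have comb (W W' : lmodType F) (h : {linear W -> W'}) (g : 'I_K -> W) :
    h (\sum_(k < K) a k *: g k) = \sum_(k < K) a k *: h (g k).
  by rewrite linear_sum; apply: eq_bigr => k _; rewrite linearZ.
exact: comb.
Qed.
End Counit.

Section CounitMaps.
Variables (F : fieldType) (U V W : lmodType F) (c : {linear V -> F^o}).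

Lemma rcounit_map (f : {linear U -> W}) (t : U ⊗ V) :
  rcounit c (tensor_map f idfun t) = f (rcounit c t).
Proof.
apply: (tensor_ext (f := rcounit c \o tensor_map f idfun) (g := f \o rcounit c)).
by move=> u v /=; rewrite tensor_mapE !rcounit_pure linearZ.
Qed.

Lemma rcounit_assoc (u : U) (t : W ⊗ V) :
  rcounit c (tensor_assoc (pure u t)) = pure u (rcounit c t).
Proof.
apply: (tensor_ext (f := rcounit c \o (@tensor_assoc F U W V \o pure u))
  (g := pure u \o rcounit c)).
by move=> w v /=; rewrite tensor_assocE !rcounit_pure linearZ.
Qed.

Lemma tensor_map_id (f : {linear U -> U}) (g : {linear W -> W}) (t : U ⊗ W) :
  f =1 id -> g =1 id -> tensor_map f g t = t.
Proof.
move=> fE gE; apply: (tensor_ext (f := tensor_map f g) (g := idfun)) => u w /=.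
by rewrite tensor_mapE fE gE.
Qed.

Lemma rcounit_assoc_map (g : {linear W -> W ⊗ V}) (t : U ⊗ W) :
  rcounit c (tensor_assoc (tensor_map idfun g t))
  = tensor_map idfun (rcounit c \o g) t.
Proof.
apply: (tensor_ext
  (f := rcounit c \o (@tensor_assoc F U W V \o tensor_map idfun g))
  (g := tensor_map idfun (rcounit c \o g))).
by move=> u w /=; rewrite !tensor_mapE rcounit_assoc.
Qed.

Lemma tensor_map_null (U' W' : lmodType F) (f : {linear U -> U'}) (g : {linear W -> W'})
    (t : U ⊗ W) : (forall w, g w = 0) -> tensor_map f g t = 0.
Proof.
move=> g0; apply: (tensor_ext (f := tensor_map f g) (g := \0)) => u w /=.
by rewrite tensor_mapE g0 linear0.
Qed.
End CounitMaps.

(** * The cocreation series and the Jacobi identity *)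

Section Skew.
Variables (F : fieldType) (V : lmodType F).
Variables (Y : {linear V -> series (V ⊗ V)}) (c : {linear V -> F^o}).
Hypothesis HV : is_vertex_coalgebra Y c.

(** The coefficient E_n of the cocreation series E(x) = (Id ⊗ c) Y(x), as a
    linear endomorphism of V rather than as a value of [counitr]. *)
Definition cocreate (n : int) : V -> V := rcounit c \o coef Y n.
HB.instance Definition _ n := GRing.Linear.on (cocreate n).

Lemma cocreate_neg n v : n < 0 -> cocreate n v = 0.
Proof. by case: (cocreation HV v) => h _; exact: h. Qed.

Lemma cocreate0 v : cocreate 0 v = v.
Proof. by case: (cocreation HV v). Qed.

(** Applying c to the remaining factor gives (c ⊗ c) Y(x) v, and so does
    applying c to the series in the left counit axiom, which is constant. *)
Lemma counit_cocreate n v : (c (cocreate n v) : F) = if n == 0 then c v else 0.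
Proof.
have -> : c (cocreate n v) = c (counitl Y c v n).
  apply: (tensor_ext (f := c \o rcounit c)
    (g := c \o (@tensor_unitl F V \o tensor_map c idfun))) => u w /=.
  rewrite rcounit_pure tensor_mapE tensor_unitlE !linearZ /=.
  exact: mulrC.
by rewrite (left_counit HV) /series_const; case: ifP => // _; rewrite linear0.
Qed.

Lemma rcounit_cocreate n (t : V ⊗ V) :
  rcounit c (tensor_map idfun (cocreate n) t) =
    if n == 0 then rcounit c t else 0.
Proof.
case: ifP => n0.
  apply: (tensor_ext (f := rcounit c \o tensor_map idfun (cocreate n))
    (g := rcounit c)) => u w /=.
  by rewrite tensor_mapE !rcounit_pure counit_cocreate n0.
apply: (tensor_ext (f := rcounit c \o tensor_map idfun (cocreate n)) (g := \0)).
by move=> u w /=; rewrite tensor_mapE rcounit_pure counit_cocreate n0 scale0r.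
Qed.

(** The Jacobi identity at x0^a x1^b x2^e.  The exponent n in (y - z)^n is
    forced by the variable that the accompanying pair of coproducts lacks: it is
    -a - 1 on the left, where x0 is missing, and b + i on the right, where x1
    is missing and i is the power of x0 taken from (x1 - x0)^n.  Only the power
    of z is summed over, and truncation makes its terms vanish once Y(x) v is
    evaluated above the bound N on its powers of x. *)
Lemma jacobi_coef v (N a b e : int) (K : nat) :
    (forall n, N < n -> Y v n = 0) ->
    N < a + b + 1 + K%:Z -> N < a + e + 1 + K%:Z -> N < b + e + 1 + K%:Z ->
  \sum_(k < K) (binomz F (- a - 1) k * (-1) ^+ k) *:
      tensor_assoc (tensor_map idfun (coef Y (e - k%:Z)) (Y v (a + b + 1 + k%:Z)))
  - \sum_(k < K) ((-1) ^ (- a - 1) * (binomz F (- a - 1) k * (-1) ^+ k)) *: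
      tensor_map (@tensor_swap F V V) idfun (tensor_assoc
        (tensor_map idfun (coef Y (b - k%:Z)) (Y v (a + e + 1 + k%:Z))))
  = \sum_(i < K) (binomz F (b + i%:Z) i * (-1) ^+ i) *:
      tensor_map (coef Y (a - i%:Z)) idfun (Y v (b + e + 1 + i%:Z)).
Proof.
move=> Y0 ltab ltae ltbe.
have jac : series3_mul (delta_x1_x2 F) (Id_Yx2_Yx1 Y v) (a, b, e)
    - series3_mul (delta_x2_x1 F) (T_Id_Yx1_Yx2 Y v) (a, b, e)
    = series3_mul (delta_x1_x0 F) (Yx0_Id_Yx2 Y v) (a, b, e).
  exact: (congr1 (fun s : series3 (V ⊗ V ⊗ V) => s (a, b, e)) (jacobi HV v)).
etransitivity; [|etransitivity; first exact: jac]; first congr (_ - _).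
- apply/esym; rewrite /series3_mul.
  rewrite (@fsum_nat _ _ (fun k : nat => (a, - a - 1 - k%:Z, k%:Z)) _ K).
  + apply: eq_bigr => k _; rewrite /delta_x1_x2 subpowN /= subrr /=.
    by congr (_ *: tensor_assoc (tensor_map _ _ (Y v _))); lia.
  + by move=> m n [].
  + move=> [[i j] k]; rewrite scaler_eq0 negb_or => /andP[/subpow_neq0[m -> ->]].
    rewrite /Id_Yx2_Yx1 /=; case: (a - i =P 0) => [ai|_]; last by rewrite eqxx.
    have -> : i = a by lia.
    move=> nz; exists m => //; rewrite ltnNge; apply: contra nz => leKm.
    by rewrite Y0 ?linear0 //; lia.
- apply/esym; rewrite /series3_mul.
  rewrite (@fsum_nat _ _ (fun k : nat => (a, k%:Z, - a - 1 - k%:Z)) _ K).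
  + apply: eq_bigr => k _; rewrite /delta_x2_x1 subpowN /= subrr /=.
    by congr (_ *: tensor_map _ _ (tensor_assoc (tensor_map _ _ (Y v _)))); lia.
  + by move=> m n [].
  + move=> [[i j] k]; rewrite scaler_eq0 mulf_eq0 !negb_or.
    move=> /andP[/andP[_ /subpow_neq0[m -> ->]]].
    rewrite /T_Id_Yx1_Yx2 /=; case: (a - i =P 0) => [ai|_]; last by rewrite eqxx.
    have -> : i = a by lia.
    move=> nz; exists m => //; rewrite ltnNge; apply: contra nz => leKm.
    by rewrite Y0 ?linear0 //; lia.
- rewrite /series3_mul.
  rewrite (@fsum_nat _ _ (fun i : nat => (i%:Z, b, - b - 1 - i%:Z)) _ K).
  + apply: eq_bigr => i _; rewrite /delta_x1_x0.
    have -> : - (- b - 1 - i%:Z) - 1 = b + i%:Z by lia.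
    rewrite -[X in subpow _ _ X _](addrK i%:Z) subpowN /= subrr /=.
    by congr (_ *: tensor_map _ _ (Y v _)); lia.
  + by move=> m n [].
  + move=> [[i j] k]; rewrite scaler_eq0 negb_or => /andP[/subpow_neq0[m -> jE]].
    rewrite /Yx0_Id_Yx2 /=; case: (b - j =P 0) => [bj|_]; last by rewrite eqxx.
    have -> : j = b by lia.
    have -> : k = - b - 1 - m%:Z by lia.
    move=> nz; exists m => //; rewrite ltnNge; apply: contra nz => leKm.
    by rewrite Y0 ?linear0 //; lia.
Qed.

(** Applying c to the last factor replaces the inner coproduct by E in the
    two terms on the left, and commutes past Y(x0) on the right because that
    acts on the other factors. *)
Lemma cocreation_jacobi v (N a b e : int) (K : nat) :
    (forall n, N < n -> Y v n = 0) ->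
    N < a + b + 1 + K%:Z -> N < a + e + 1 + K%:Z -> N < b + e + 1 + K%:Z ->
  \sum_(k < K) (binomz F (- a - 1) k * (-1) ^+ k) *:
      tensor_map idfun (cocreate (e - k%:Z)) (Y v (a + b + 1 + k%:Z))
  - \sum_(k < K) ((-1) ^ (- a - 1) * (binomz F (- a - 1) k * (-1) ^+ k)) *:
      tensor_swap
        (tensor_map idfun (cocreate (b - k%:Z)) (Y v (a + e + 1 + k%:Z)))
  = \sum_(i < K) (binomz F (b + i%:Z) i * (-1) ^+ i) *:
      Y (cocreate (b + e + 1 + i%:Z) v) (a - i%:Z).
Proof.
move=> Y0 ltab ltae ltbe.
have := congr1 (rcounit c) (jacobi_coef Y0 ltab ltae ltbe).
rewrite raddfB /= !rcounit_sum => E.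
etransitivity; [|etransitivity; first exact: E]; first congr (_ - _).
- by apply: eq_bigr => k _; rewrite rcounit_assoc_map.
- by apply: eq_bigr => k _; rewrite rcounit_map rcounit_assoc_map.
- by apply: eq_bigr => k _; rewrite rcounit_map.
Qed.

(** * The cocreation series is an exponential *)

(** Obtained from the coefficient of x0^n x1^-1 x2^1 after a second application
    of c.  With x1^-1 the second term of the Jacobi identity has only
    coefficients of E of negative index, and on the right the binomials
    (i - 1 choose i) leave only i = 0, which is E_n E_1.  On the left c E_j = 0
    for j <> 0 leaves only k = 1, with coefficient -(-n - 1 choose 1). *)
Lemma cocreate_Dstar n v :
  cocreate n (Dstar Y c v) = (n + 1)%:~R *: cocreate (n + 1) v.
Proof.
have [N Y0] := truncation HV v.
(* The cutoff K.+2 lets the terms of index 0 and 1 be split off. *)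
pose K := (`|N| + `|n|)%N.
have : N < n + -1 + 1 + K.+2%:Z by lia.
have : N < n + 1 + 1 + K.+2%:Z by lia.
have : N < -1 + 1 + 1 + K.+2%:Z by lia.
move: K => K lt3 lt2 lt1.
have := congr1 (rcounit c) (cocreation_jacobi Y0 lt1 lt2 lt3).
rewrite raddfB /= [X in _ - rcounit c X]big1 ?raddf0 ?subr0; last first.
  move=> k _; rewrite tensor_map_null ?raddf0 ?scaler0 // => w.
  by apply: cocreate_neg; lia.
rewrite !rcounit_sum 2!big_ord_recl [X in _ + (_ + X)]big1; last first.
  by move=> k _; rewrite rcounit_cocreate (_ : (1 - _ == 0) = false) ?scaler0.
rewrite big_ord_recl [X in _ = _ + X]big1; last first.
  by move=> k _; rewrite lift0 addrC binomz_pred // mul0r scale0r.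
rewrite !rcounit_cocreate lift0 /= !binomz0 binomz1.
rewrite scaler0 add0r !addr0 mul1r expr0 expr1 scale1r mulrN1 -rmorphN.
by rewrite (_ : - (- n - 1) = n + 1) ?subrK ?subr0 //; lia.
Qed.

Lemma cocreateE (charF : [pchar F] =i pred0) (n : nat) v :
  cocreate n v = (n`!%:R : F)^-1 *: iter n (Dstar Y c) v.
Proof.
elim: n v => [|n IH] v; first by rewrite cocreate0 fact0 invr1 scale1r.
have nz : n.+1%:R != 0 :> F by rewrite ((pcharf0P F).1 charF).
apply: (scalerI nz); rewrite scalerA factS natrM invfM mulrA divff // mul1r.
by rewrite iterSr -IH cocreate_Dstar -addn1 PoszD -pmulrn.
Qed.

Lemma cocreate_trunc v (N n : int) :
  (forall n, N < n -> Y v n = 0) -> N < n -> cocreate n v = 0.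
Proof. by move=> Y0 ltNn; rewrite /cocreate /= /coef Y0 ?raddf0. Qed.

Lemma exp_series_cocreate (charF : [pchar F] =i pred0) v n :
  exp_series (Dstar Y c) v n = cocreate n v.
Proof.
by case: n => n /=; [rewrite -(cocreateE charF) | rewrite cocreate_neg].
Qed.

(** * Skew symmetry *)

(** The coefficient of x0^m x1^0 x2^-1: the first term of the Jacobi identity
    only involves E_(-1-k) = 0, the second only k = 0 where E_0 = Id, and on
    the right the binomials (i choose i) are 1. *)
Lemma swap_coef (charF : [pchar F] =i pred0) v (N m : int) (K : nat) :
    (forall n, N < n -> Y v n = 0) -> N < K%:Z -> N < m + K%:Z -> (0 < K)%N ->
  tensor_swap (Y v m) =
    \sum_(k < K) (-1 : F) ^ (m - k%:Z) *: Y (cocreate k v) (m - k%:Z).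
Proof.
move=> Y0 ltK ltmK; case: K => // K in ltK ltmK * => _.
have lt1 : N < m + 0 + 1 + K.+1%:Z by lia.
have lt2 : N < m + (- 1) + 1 + K.+1%:Z by lia.
have lt3 : N < 0 + (- 1) + 1 + K.+1%:Z by lia.
have := cocreation_jacobi Y0 lt1 lt2 lt3.
rewrite big1 ?sub0r; last first.
  move=> k _; rewrite tensor_map_null ?scaler0 // => w.
  by apply: cocreate_neg; lia.
rewrite big_ord_recl [X in _ + X]big1 ?addr0; last first.
  move=> k _; rewrite tensor_map_null ?linear0 ?scaler0 // => w.
  by apply: cocreate_neg; rewrite lift0; lia.
rewrite binomz0 expr0 !mulr1 subrK tensor_map_id //; last exact: cocreate0.
(* The term with T comes with the sign -(-1)^(-m-1) = (-1)^m. *)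
move/(congr1 (fun t => (-1 : F) ^ m *: t)).
rewrite -scaleNr scalerA mulrN -expfzDr ?oppr_eq0 ?oner_eq0 //.
rewrite (_ : m + (- m - 1) = -1) ?exprN1 ?invrN1 ?opprK ?scale1r; last by lia.
move->; rewrite scaler_sumr; apply: eq_bigr => k _.
rewrite add0r binomz_id // mul1r scalerA expfzDr ?oppr_eq0 ?oner_eq0 //.
by rewrite -exprnN invr_sign.
Qed.

End Skew.

Theorem proposition2p3 (F : fieldType) (charF : [pchar F] =i pred0)
    (V : lmodType F) (Y : {linear V -> series (V ⊗ V)})
    (c : {linear V -> F^o}) (HV : is_vertex_coalgebra Y c) (v : V) :
  series_applicable (fun w => series_opp (Y w)) (exp_series (Dstar Y c) v) /\
  (fun n => tensor_swap (Y v n)) =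
    series_apply (fun w => series_opp (Y w)) (exp_series (Dstar Y c) v).
Proof.
have [N Y0] := truncation HV v.
have supp (K : nat) n i : N < K%:Z ->
    series_opp (Y (exp_series (Dstar Y c) v i)) (n - i) != 0 ->
    exists2 k, (k < K)%N & i = k%:Z.
  move=> ltNK; rewrite exp_series_cocreate //; case: i => [k|k].
    move=> nz; exists k => //; rewrite ltnNge; apply: contra nz => leKk.
    by rewrite (cocreate_trunc _ Y0) ?linear0 /series_opp ?scaler0 //; lia.
  by rewrite (cocreate_neg HV) // linear0 /series_opp scaler0 eqxx.
split=> [n|].
  have ltNK : N < (`|N| + 1)%N%:Z by lia.
  apply: sub_finite_set (finite_image Posz (finite_II (`|N| + 1))) => i nz.
  by have [k ltkK ->] := supp _ _ _ ltNK nz; exists k.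
apply/funext => n; rewrite /series_apply.
(* The cutoff has to exceed N for E and N - n for the coproduct. *)
have ltNK : N < (`|N| + `|n| + 1)%N%:Z by lia.
rewrite (fsum_nat _ (supp _ n ^~ ltNK)); last by move=> ? ? [].
rewrite (swap_coef HV charF Y0 ltNK); [|lia|lia].
by apply: eq_bigr => k _; rewrite exp_series_cocreate.
Qed.
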